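(* Suppose that $a,\kappa^2,f$ are smooth functions on $(0,1)$ with $a>0$. Let $M,\tilde M$ be positive integers with $M\ge\tilde M$. Let $0<h<1$ and $x_b\in(0,1)$ such that $(x_b-h,x_b+h)\subset(0,1)$. Consider the discretization stencil of a compact finite difference scheme for $\mathcal{L}u:=[a(x)u'(x)]'+\kappa^2(x)u(x)=f(x)$ at the base point $x_b$: $$\mathcal{L}_hu(x_b):=h^{-2}\bigl[c_{-1}(h)u(x_b-h)+c_0(h)u(x_b)+c_1(h)u(x_b+h)\bigr]-\sum_{\ell=0}^{\tilde M-1}d_\ell(h)h^\ell f^{(\ell)}(x_b),$$ where $c_{-1},c_0,c_1$ and $d_\ell$, $\ell=0,\dots,\tilde M-1$, are smooth functions of $h$. Suppose that, as $h\to0$, $$c_1(h)=\frac{\alpha(h)}{E_1(h)}+O(h^{M+1}),\qquad c_{-1}(h)=\frac{\alpha(h)}{E_1(-h)}+O(h^{M+1}),$$ $$c_0(h)=-c_1(h)E_0(h)-c_{-1}(h)E_0(-h)+O(h^{M+2}),$$ and $$d_\ell(h)=-\delta_{0,\ell}+c_1(h)F_\ell(h)+(-1)^\ell c_{-1}(h)F_\ell(-h)+O(h^{\tilde M-\ell}),\qquad \ell=0,\dots,\tilde M-1,$$ where $\alpha$ is a smooth function of $h$ with $\alpha(0)\neq0$. Then the stencil has numerical dispersion order $M$ at $x_b$, that is, $$h^{-2}\bigl[c_{-1}(h)u(x_b-h)+c_0(h)u(x_b)+c_1(h)u(x_b+h)\bigr]=O(h^M),\qquad h\to0,$$ for every solution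 $u$ of $\mathcal{L}u=0$, and has accuracy order $\tilde M$ at $x_b$, that is, $$\mathcal{L}_hu(x_b)-f(x_b)=O(h^{\tilde M}),\qquad h\to0,$$ for every solution $u$ of $\mathcal{L}u=f$.
   Context: $\delta_{0,\ell}=1$ if $\ell=0$ and $0$ otherwise. Smooth means infinitely differentiable; $\kappa^2$ is treated as a single function. Definition of $E_0,E_1,F_\ell$ (relative to the base point $x_b$). Differentiating the equation $u''=-\frac{\kappa^2}{a}u-\frac{a'}{a}u'+\frac fa$ repeatedly gives, for every solution $u$ of $\mathcal{L}u=f$ and every $j\ge2$, $$u^{(j)}=E_{j,0}u+E_{j,1}u'+\sum_{\ell=0}^{j-2}F_{j,\ell}f^{(\ell)},$$ where the coefficients, as functions of $x$, are given by $$E_{2,0}=-\tfrac{\kappa^2}{a},\quad E_{2,1}=-\tfrac{a'}{a},\quad F_{2,0}=\tfrac1a,$$ $$E_{j+1,0}=E_{j,0}'-\tfrac{\kappa^2}{a}E_{j,1},\quad E_{j+1,1}=E_{j,0}+E_{j,1}'-\tfrac{a'}{a}E_{j,1},\quad F_{j+1,\ell}=F_{j,\ell}'+F_{j,\ell-1}\quad(j\ge2,\ 0\le\ell\le j-1),$$ with the conventions $F_{j,-1}:=E_{j,1}/a$ and $F_{j,\ell}:=0$ for $\ell>j-2$. With all these coefficients evaluated at $x_b$, $$E_0(h):=1+\sum_{j=2}^\infty\frac{E_{j,0}}{j!}h^j,\qquad E_1(h):=1+\sum_{j=2}^\infty\frac{E_{j,1}}{j!}h^{j-1},\qquad F_\ell(h):=\sum_{j=\ell+2}^\infty\frac{F_{j,\ell}}{j!}h^{j-\ell-2},\quad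 \ell\in\mathbb{N}\cup\{0\}.$$ For coefficients that are only smooth, these are understood as formal power series in $h$ (and $1/E_1$ as the formal reciprocal); they enter only through relations modulo $O(h^n)$, which means that each series may be replaced by its truncation to a sufficiently high order. *)

(* Defs.v *)
From Stdlib Require Import Reals Lia Factorial Arith.
From Coquelicot Require Import Coquelicot.
Open Scope R_scope.

Definition smooth_on (lo hi : R) (g : R -> R) : Prop :=
  forall (n : nat) (x : R), lo < x < hi -> ex_derive_n g n x.

(* Step sizes are positive, so [h -> 0] is the one-sided limit. *)
Definition bigO (n : nat) (g : R -> R) : Prop :=
  exists C : R, at_right 0 (fun h => Rabs (g h) <= C * h ^ n).

Definition eq_bigO (n : nat) (g1 g2 : R -> R) : Prop :=
  bigO n (fun h => g1 h - g2 h).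

(* Classical solution on (0,1) of (a u')' + kappa2 u = f.  Functions are total,
   but only their values on (0,1) matter. *)
Definition solution (a kappa2 f u : R -> R) : Prop :=
  forall x : R, 0 < x < 1 ->
    ex_derive u x /\
    ex_derive (fun y => a y * Derive u y) x /\
    Derive (fun y => a y * Derive u y) x + kappa2 x * u x = f x.

(* The pair (E_{j,0}, E_{j,1}) as functions of x.  Only [2 <= j] is meaningful;
   the values at j = 0, 1 are never used. *)
Fixpoint Ecoef (a kappa2 : R -> R) (j : nat) : (R -> R) * (R -> R) :=
  match j with
  | S (S (S _) as i) =>
      let (e0, e1) := Ecoef a kappa2 i in
      (fun x => Derive e0 x - kappa2 x / a x * e1 x,
       fun x => e0 x + Derive e1 x - Derive a x / a x * e1 x)
  | _ => (fun x => - (kappa2 x / a x), fun x => - (Derive a x / a x))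
  end.

(* F_{j,l} as a function of x, again for [2 <= j], with F_{j,l} = 0 for
   l > j - 2 and F_{j,-1} = E_{j,1} / a. *)
Fixpoint Fcoef (a kappa2 : R -> R) (j l : nat) : R -> R :=
  match j with
  | S (S (S _) as i) =>
      if Nat.leb l (i - 1) then
        fun x => Derive (Fcoef a kappa2 i l) x +
                 match l with
                 | O => snd (Ecoef a kappa2 i) x / a x
                 | S l' => Fcoef a kappa2 i l' x
                 end
      else fun _ => 0
  | _ => match l with
         | O => fun x => 1 / a x
         | S _ => fun _ => 0
         end
  end.

(* A formal power series in h is its sequence of coefficients, as for
   Coquelicot's [PS_mult]. *)
Definition E0_series (a kappa2 : R -> R) (xb : R) (j : nat) : R :=
  match j with
  | O => 1
  | S O => 0
  | _ => fst (Ecoef a kappa2 j) xb / INR (fact j)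
  end.

Definition E1_series (a kappa2 : R -> R) (xb : R) (i : nat) : R :=
  match i with
  | O => 1
  | _ => snd (Ecoef a kappa2 (i + 1)) xb / INR (fact (i + 1))
  end.

Definition F_series (a kappa2 : R -> R) (xb : R) (l i : nat) : R :=
  Fcoef a kappa2 (i + l + 2) l xb / INR (fact (i + l + 2)).

(* Reciprocal of a formal power series: r_0 = 1/s_0 and
   r_{m+1} = - (s_1 r_m + ... + s_{m+1} r_0) / s_0.
   [PS_inv_upto s n] is correct at the indices up to n. *)
Fixpoint PS_inv_upto (s : nat -> R) (n : nat) : nat -> R :=
  match n with
  | O => fun _ => / s O
  | S m => fun k =>
      if Nat.leb k m then PS_inv_upto s m k
      else - (sum_f_R0 (fun i => s (S i) * PS_inv_upto s m (m - i)%nat) m) / s O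
  end.

Definition PS_inv (s : nat -> R) (n : nat) : R := PS_inv_upto s n n.

Lemma PS_inv_upto_eq (s : nat -> R) (n k : nat) :
  (k <= n)%nat -> PS_inv_upto s n k = PS_inv s k.
Proof.
  induction n as [|n IH]; intros Hk.
  - now replace k with O by lia.
  - destruct (Nat.eq_dec k (S n)) as [->|Hne]; [reflexivity|].
    simpl. rewrite (proj2 (Nat.leb_le k n)) by lia. apply IH; lia.
Qed.

Lemma PS_mult_inv (s : nat -> R) (n : nat) :
  s O <> 0 -> PS_mult s (PS_inv s) n = match n with O => 1 | S _ => 0 end.
Proof.
  intros Hs. unfold PS_mult. destruct n as [|m].
  - simpl. unfold PS_inv; simpl. now field.
  - assert (Hm : PS_inv s (S m) =
      - (sum_f_R0 (fun i => s (S i) * PS_inv_upto s m (m - i)%nat) m) / s O).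
    { unfold PS_inv.
      change (PS_inv_upto s (S m) (S m)) with
        (if Nat.leb (S m) m then PS_inv_upto s m (S m)
         else - (sum_f_R0 (fun i => s (S i) * PS_inv_upto s m (m - i)%nat) m) / s O).
      now rewrite (proj2 (Nat.leb_gt (S m) m)) by lia. }
    rewrite decomp_sum by lia.
    rewrite Nat.sub_0_r, Hm.
    rewrite (sum_eq (fun i => s (S i) * PS_inv s (S m - S i)%nat)
               (fun i => s (S i) * PS_inv_upto s m (m - i)%nat)).
    + simpl pred. now field.
    + intros i Hi. rewrite PS_inv_upto_eq by lia. now rewrite Nat.sub_succ.
Qed.

(* Truncation at degree n.  A relation modulo O(h^n) between series is read on
   this truncation, since the omitted terms are O(h^(n+1)). *)
Definition PS_trunc (s : nat -> R) (n : nat) (h : R) : R :=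
  sum_f_R0 (fun i => s i * h ^ i) n.

Definition delta0 (l : nat) : R := match l with O => 1 | S _ => 0 end.

Definition stencil_u (cm1 c0 c1 : R -> R) (u : R -> R) (xb h : R) : R :=
  / h ^ 2 * (cm1 h * u (xb - h) + c0 h * u xb + c1 h * u (xb + h)).

(* For [1 <= Mt] the sum runs over l = 0, ..., Mt - 1. *)
Definition Lh (cm1 c0 c1 : R -> R) (d : nat -> R -> R) (Mt : nat)
    (f u : R -> R) (xb h : R) : R :=
  stencil_u cm1 c0 c1 u xb h -
  sum_f_R0 (fun l => d l h * h ^ l * Derive_n f l xb) (Mt - 1).

Definition dispersion_order (a kappa2 : R -> R) (cm1 c0 c1 : R -> R)
    (xb : R) (M : nat) : Prop :=
  forall u : R -> R, solution a kappa2 (fun _ => 0) u ->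
    bigO M (fun h => stencil_u cm1 c0 c1 u xb h).

(* The right-hand side f and the number Md of terms d_l are those of the
   scheme; m is the order. *)
Definition accuracy_order (a kappa2 f : R -> R) (cm1 c0 c1 : R -> R)
    (d : nat -> R -> R) (Md : nat) (xb : R) (m : nat) : Prop :=
  forall u : R -> R, solution a kappa2 f u ->
    bigO m (fun h => Lh cm1 c0 c1 d Md f u xb h - f xb).

(* Main.v *)
Require Import Defs.
From Stdlib Require Import Reals Lra Lia Arith.
From Coquelicot Require Import Coquelicot.
Open Scope R_scope.

(** Taylor's formula writes u(x_b + s h), for s = 1 and s = -1, through the
    derivatives of u at x_b.  The differential equation expresses each of these,
    from the second on, by u, u' and the derivatives of f at x_b
    ([solution_Derive_n]).  Collecting terms turns the Taylor polynomial into

      u(x_b) E_0(sh) + sh u'(x_b) E_1(sh) + sum_l (sh)^(l+2) f^(l)(x_b) F_l(sh)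

    with each series cut at the matching degree ([solution_taylor_PS]).
    Multiply by the weight c_s(h) of the corresponding node.  As
    c_s E_1(sh) = alpha + O(h^(M+1)), the two u'-terms are h u' alpha and
    - h u' alpha up to O(h^(M+2)), and cancel in the sum; the u-terms are
    compensated by c_0.  After division by h^2 only the f-terms are left
    ([stencil_expansion]).  They vanish when f = 0, which gives the dispersion
    order; in general the d_l subtract them and the part - delta_{0,l} of d_l
    supplies f(x_b), which gives the accuracy order.

    The two nodes are handled by one argument in which s is an arbitrary real
    number ([taylor_shift], [weighted_shift]): all the remainder estimates only
    see |s h|^n, so the substitution of - h in a series needs no separate
    treatment. *)

(** * Smooth functions on an open interval *)

(** Smoothness of products, quotients and solutions is shown by induction on the
    number of derivatives.  All orders up to n are kept together because the
    Leibniz rule for the n-th derivative involves all the lower ones. *)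
Definition diff_upto (lo hi : R) (n : nat) (g : R -> R) : Prop :=
  forall (k : nat) (x : R), (k <= n)%nat -> lo < x < hi -> ex_derive_n g k x.

Lemma smooth_on_diff_upto (lo hi : R) (g : R -> R) :
  smooth_on lo hi g <-> forall n, diff_upto lo hi n g.
Proof.
  split.
  - intros Hg n k x _ Hx. now apply Hg.
  - intros Hg n x Hx. now apply (Hg n n x).
Qed.

Lemma locally_open_interval (lo hi x : R) (P : R -> Prop) :
  lo < x < hi -> (forall y, lo < y < hi -> P y) -> locally x P.
Proof.
  intros Hx HP.
  apply (locally_interval P x lo hi); simpl; try apply Hx.
  intros y Hl Hr. now apply HP.
Qed.

Lemma diff_upto_ext (lo hi : R) (n : nat) (g1 g2 : R -> R) :
  (forall x, lo < x < hi -> g1 x = g2 x) ->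
  diff_upto lo hi n g1 -> diff_upto lo hi n g2.
Proof.
  intros He Hg k x Hk Hx.
  apply ex_derive_n_ext_loc with g1; [|now apply Hg].
  now apply (locally_open_interval lo hi).
Qed.

(** Peeling off the innermost derivative, whereas [Derive_n] peels off the
    outermost: this is the form in which the rules for a first derivative drive
    an induction. *)
Lemma diff_upto_S (lo hi : R) (n : nat) (g : R -> R) :
  diff_upto lo hi (S n) g <->
  (forall x, lo < x < hi -> ex_derive g x) /\ diff_upto lo hi n (Derive g).
Proof.
  assert (shift : forall k x,
    ex_derive_n g (S (S k)) x <-> ex_derive_n (Derive g) (S k) x).
  { intros k x. simpl.
    assert (He : forall t, Derive_n (Derive g) k t = Derive (Derive_n g k) t).
    { intros t. change (Derive g) with (Derive_n g 1).
      rewrite Derive_n_comp. now replace (k + 1)%nat with (S k) by lia. }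
    split; apply ex_derive_ext; intros t; now rewrite He. }
  split.
  - intros Hg. split.
    + intros x Hx. exact (Hg 1%nat x ltac:(lia) Hx).
    + intros [|k] x Hk Hx; [exact I|].
      apply (proj1 (shift k x)). apply (Hg (S (S k)) x); [lia|assumption].
  - intros [H1 Hg] [|[|k]] x Hk Hx; [exact I|now apply H1|].
    apply (proj2 (shift k x)). apply (Hg (S k) x); [lia|assumption].
Qed.

Lemma diff_upto_pred (lo hi : R) (n : nat) (g : R -> R) :
  diff_upto lo hi (S n) g -> diff_upto lo hi n g.
Proof. intros Hg k x Hk Hx. apply Hg; [lia|assumption]. Qed.

Lemma diff_upto_plus (lo hi : R) (n : nat) (g1 g2 : R -> R) :
  diff_upto lo hi n g1 -> diff_upto lo hi n g2 ->
  diff_upto lo hi n (fun x => g1 x + g2 x).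
Proof.
  intros H1 H2 k x Hk Hx.
  apply ex_derive_n_plus; apply (locally_open_interval lo hi); try assumption;
    intros y Hy j Hj; [apply H1|apply H2]; try assumption; lia.
Qed.

Lemma diff_upto_opp (lo hi : R) (n : nat) (g : R -> R) :
  diff_upto lo hi n g -> diff_upto lo hi n (fun x => - g x).
Proof. intros Hg k x Hk Hx. now apply ex_derive_n_opp, Hg. Qed.

Lemma diff_upto_mult (lo hi : R) (n : nat) : forall g1 g2 : R -> R,
  diff_upto lo hi n g1 -> diff_upto lo hi n g2 ->
  diff_upto lo hi n (fun x => g1 x * g2 x).
Proof.
  induction n as [|n IH]; intros g1 g2 H1 H2.
  - intros k x Hk Hx. replace k with O by lia. exact I.
  - pose proof (diff_upto_pred _ _ _ _ H1) as H1'.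
    pose proof (diff_upto_pred _ _ _ _ H2) as H2'.
    apply diff_upto_S in H1; apply diff_upto_S in H2.
    destruct H1 as [E1 D1], H2 as [E2 D2].
    apply diff_upto_S. split.
    + intros x Hx. apply ex_derive_mult; auto.
    + apply diff_upto_ext with (fun x => Derive g1 x * g2 x + g1 x * Derive g2 x).
      * intros x Hx. rewrite Derive_mult; auto.
      * apply diff_upto_plus; auto.
Qed.

Lemma diff_upto_inv (lo hi : R) (n : nat) (g : R -> R) :
  (forall x, lo < x < hi -> g x <> 0) ->
  diff_upto lo hi n g -> diff_upto lo hi n (fun x => / g x).
Proof.
  intros Hnz. induction n as [|n IH]; intros Hg.
  - intros k x Hk Hx. replace k with O by lia. exact I.
  - pose proof (IH (diff_upto_pred _ _ _ _ Hg)) as Hinv.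
    apply diff_upto_S in Hg. destruct Hg as [Ex Dg].
    apply diff_upto_S. split.
    + intros x Hx. apply ex_derive_inv; auto.
    + apply diff_upto_ext with (fun x => - (Derive g x * (/ g x * / g x))).
      * intros x Hx. rewrite Derive_inv by auto. field. auto.
      * apply diff_upto_opp, diff_upto_mult; [assumption|].
        now apply diff_upto_mult.
Qed.

Lemma smooth_on_ext (lo hi : R) (g1 g2 : R -> R) :
  (forall x, lo < x < hi -> g1 x = g2 x) ->
  smooth_on lo hi g1 -> smooth_on lo hi g2.
Proof.
  rewrite !smooth_on_diff_upto. intros He H n.
  now apply diff_upto_ext with g1.
Qed.

Lemma smooth_on_plus (lo hi : R) (g1 g2 : R -> R) :
  smooth_on lo hi g1 -> smooth_on lo hi g2 ->
  smooth_on lo hi (fun x => g1 x + g2 x).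
Proof. rewrite !smooth_on_diff_upto. intros; now apply diff_upto_plus. Qed.

Lemma smooth_on_opp (lo hi : R) (g : R -> R) :
  smooth_on lo hi g -> smooth_on lo hi (fun x => - g x).
Proof. rewrite !smooth_on_diff_upto. intros; now apply diff_upto_opp. Qed.

Lemma smooth_on_mult (lo hi : R) (g1 g2 : R -> R) :
  smooth_on lo hi g1 -> smooth_on lo hi g2 ->
  smooth_on lo hi (fun x => g1 x * g2 x).
Proof. rewrite !smooth_on_diff_upto. intros; now apply diff_upto_mult. Qed.

Lemma smooth_on_div (lo hi : R) (g1 g2 : R -> R) :
  (forall x, lo < x < hi -> g2 x <> 0) ->
  smooth_on lo hi g1 -> smooth_on lo hi g2 ->
  smooth_on lo hi (fun x => g1 x / g2 x).
Proof.
  intros Hnz H1 H2. apply smooth_on_mult; [assumption|].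
  revert H2. rewrite !smooth_on_diff_upto. intros; now apply diff_upto_inv.
Qed.

Lemma smooth_on_const (lo hi c : R) : smooth_on lo hi (fun _ => c).
Proof. intros n x _. apply ex_derive_n_const. Qed.

Lemma smooth_on_Derive (lo hi : R) (g : R -> R) :
  smooth_on lo hi g -> smooth_on lo hi (Derive g).
Proof.
  rewrite !smooth_on_diff_upto. intros H n. now apply diff_upto_S, H.
Qed.

Lemma smooth_on_ex_derive (lo hi : R) (g : R -> R) (x : R) :
  smooth_on lo hi g -> lo < x < hi -> ex_derive g x.
Proof. intros H Hx. exact (H 1%nat x Hx). Qed.

(** * Remainders as the step size tends to zero *)

Lemma at_right_0_small (e : R) : 0 < e -> at_right 0 (fun h => 0 < h < e).
Proof.
  intros He. exists (mkposreal e He). intros h Hh Hpos. split; [exact Hpos|].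
  change (Rabs (h - 0) < e) in Hh. rewrite Rminus_0_r in Hh.
  apply Rle_lt_trans with (2 := Hh), Rle_abs.
Qed.

(** The equality is only asked for small positive h, so that division by h^2 can be
    simplified under it. *)
Lemma bigO_ext_small (n : nat) (g1 g2 : R -> R) (e : R) :
  0 < e -> (forall h, 0 < h < e -> g1 h = g2 h) -> bigO n g1 -> bigO n g2.
Proof.
  intros He Heq [C HC]. exists C.
  generalize (filter_and _ _ (at_right_0_small e He) HC). apply filter_imp.
  intros h [Hh HCh]. now rewrite <- Heq.
Qed.

Lemma bigO_ext (n : nat) (g1 g2 : R -> R) :
  (forall h, g1 h = g2 h) -> bigO n g1 -> bigO n g2.
Proof. intros Heq. apply bigO_ext_small with 1; [lra|auto]. Qed.

Lemma bigO_plus (n : nat) (g1 g2 : R -> R) :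
  bigO n g1 -> bigO n g2 -> bigO n (fun h => g1 h + g2 h).
Proof.
  intros [C1 H1] [C2 H2]. exists (C1 + C2).
  generalize (filter_and _ _ H1 H2). apply filter_imp.
  intros h [K1 K2]. generalize (Rabs_triang (g1 h) (g2 h)). lra.
Qed.

Lemma bigO_mult (n m : nat) (g1 g2 : R -> R) :
  bigO n g1 -> bigO m g2 -> bigO (n + m) (fun h => g1 h * g2 h).
Proof.
  intros [C1 H1] [C2 H2]. exists (C1 * C2).
  generalize (filter_and _ _ H1 H2). apply filter_imp.
  intros h [K1 K2]. rewrite Rabs_mult, pow_add.
  replace (C1 * C2 * (h ^ n * h ^ m)) with ((C1 * h ^ n) * (C2 * h ^ m)) by ring.
  apply Rmult_le_compat; auto using Rabs_pos.
Qed.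

Lemma bigO_const (c : R) : bigO 0 (fun _ => c).
Proof.
  exists (Rabs c). apply filter_forall. intros h. simpl. lra.
Qed.

Lemma bigO_pow (s : R) (n : nat) : bigO n (fun h => (s * h) ^ n).
Proof.
  exists (Rabs s ^ n).
  generalize (at_right_0_small 1 Rlt_0_1). apply filter_imp.
  intros h Hh. rewrite <- RPow_abs, Rabs_mult, (Rabs_pos_eq h) by lra.
  rewrite Rpow_mult_distr. lra.
Qed.

Lemma bigO_weaken (n m : nat) (g : R -> R) :
  (n <= m)%nat -> bigO m g -> bigO n g.
Proof.
  intros Hnm [C HC]. exists (Rabs C).
  generalize (filter_and _ _ (at_right_0_small 1 Rlt_0_1) HC). apply filter_imp.
  intros h [Hh HCh].
  replace m with (n + (m - n))%nat in HCh by lia. rewrite pow_add in HCh.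
  apply Rle_trans with (1 := HCh).
  assert (0 <= h ^ n) by (apply pow_le; lra).
  assert (0 <= h ^ (m - n)) by (apply pow_le; lra).
  assert (h ^ (m - n) <= 1).
  { rewrite <- (pow1 (m - n)). apply pow_incr. lra. }
  assert (C <= Rabs C) by apply Rle_abs. pose proof (Rabs_pos C).
  apply Rle_trans with (Rabs C * (h ^ n * h ^ (m - n))).
  - apply Rmult_le_compat_r; [now apply Rmult_le_pos|assumption].
  - apply Rmult_le_compat_l; [assumption|]. nra.
Qed.

Lemma bigO_scal (n : nat) (g1 g2 : R -> R) :
  bigO 0 g1 -> bigO n g2 -> bigO n (fun h => g1 h * g2 h).
Proof. exact (bigO_mult 0 n g1 g2). Qed.

Lemma bigO_sum (n N : nat) (G : nat -> R -> R) :
  (forall l, (l <= N)%nat -> bigO n (G l)) ->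
  bigO n (fun h => sum_f_R0 (fun l => G l h) N).
Proof.
  induction N as [|N IH]; intros HG; simpl.
  - now apply (HG O).
  - apply bigO_plus; [apply IH; intros l Hl|]; apply HG; lia.
Qed.

Lemma bigO_div_sqr (n : nat) (g : R -> R) :
  bigO (n + 2) g -> bigO n (fun h => / h ^ 2 * g h).
Proof.
  intros [C HC]. exists C.
  generalize (filter_and _ _ (at_right_0_small 1 Rlt_0_1) HC). apply filter_imp.
  intros h [Hh HCh]. assert (Hh2 : 0 < h ^ 2) by (apply pow_lt; lra).
  rewrite Rabs_mult, (Rabs_pos_eq (/ h ^ 2))
    by now apply Rlt_le, Rinv_0_lt_compat.
  rewrite pow_add in HCh.
  apply Rmult_le_reg_l with (1 := Hh2).
  rewrite <- Rmult_assoc, Rinv_r, Rmult_1_l by lra. lra.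
Qed.

Lemma continuous_scaled_bigO (s : R) (g : R -> R) :
  continuous g 0 -> bigO 0 (fun h => g (s * h)).
Proof.
  intros Hg. exists (Rabs (g (s * 0)) + 1).
  assert (Hc : continuous (fun h => g (s * h)) 0).
  { apply (continuous_comp (fun h => s * h) g).
    - apply (continuous_mult (fun _ => s) (fun h => h));
        [apply continuous_const|apply continuous_id].
    - now rewrite Rmult_0_r. }
  unfold continuous in Hc.
  destruct (proj1 (filterlim_locally _ _) Hc (mkposreal 1 Rlt_0_1)) as [e He].
  exists e. intros h Hh _.
  assert (Hball : Rabs (g (s * h) - g (s * 0)) < 1) by exact (He h Hh).
  simpl pow. generalize (Rabs_triang_inv (g (s * h)) (g (s * 0))). lra.
Qed.

Lemma smooth_on_bigO (e : R) (g : R -> R) :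
  0 < e -> smooth_on (- e) e g -> bigO 0 g.
Proof.
  intros He Hg. apply bigO_ext with (fun h => g (1 * h)).
  { intros h. now rewrite Rmult_1_l. }
  apply continuous_scaled_bigO.
  apply (ex_derive_continuous (K := R_AbsRing) (V := R_NormedModule)).
  apply (smooth_on_ex_derive (- e) e); [assumption|lra].
Qed.

Lemma eq_bigO_ext (n : nat) (g1 g2 : R -> R) :
  (forall h, g1 h = g2 h) -> eq_bigO n g1 g2.
Proof.
  intros He. exists 0. apply filter_forall. intros h.
  rewrite He, Rminus_diag, Rabs_R0. lra.
Qed.

Lemma eq_bigO_sym (n : nat) (g1 g2 : R -> R) :
  eq_bigO n g1 g2 -> eq_bigO n g2 g1.
Proof.
  intros H. apply bigO_ext with (fun h => -1 * (g1 h - g2 h)); [intros; ring|].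
  apply bigO_scal; [apply bigO_const|exact H].
Qed.

Lemma eq_bigO_trans (n : nat) (g1 g2 g3 : R -> R) :
  eq_bigO n g1 g2 -> eq_bigO n g2 g3 -> eq_bigO n g1 g3.
Proof.
  intros H1 H2.
  apply bigO_ext with (fun h => (g1 h - g2 h) + (g2 h - g3 h)); [intros; ring|].
  now apply bigO_plus.
Qed.

Lemma eq_bigO_plus (n : nat) (g1 g2 k1 k2 : R -> R) :
  eq_bigO n g1 g2 -> eq_bigO n k1 k2 ->
  eq_bigO n (fun h => g1 h + k1 h) (fun h => g2 h + k2 h).
Proof.
  intros H1 H2.
  apply bigO_ext with (fun h => (g1 h - g2 h) + (k1 h - k2 h)); [intros; ring|].
  now apply bigO_plus.
Qed.

Lemma eq_bigO_mult_l (n m : nat) (k g1 g2 : R -> R) :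
  bigO n k -> eq_bigO m g1 g2 ->
  eq_bigO (n + m) (fun h => k h * g1 h) (fun h => k h * g2 h).
Proof.
  intros Hk H.
  apply bigO_ext with (fun h => k h * (g1 h - g2 h)); [intros; ring|].
  now apply bigO_mult.
Qed.

Lemma eq_bigO_sum (n N : nat) (G K : nat -> R -> R) :
  (forall l, (l <= N)%nat -> eq_bigO n (G l) (K l)) ->
  eq_bigO n (fun h => sum_f_R0 (fun l => G l h) N)
            (fun h => sum_f_R0 (fun l => K l h) N).
Proof.
  intros H.
  apply bigO_ext with (fun h => sum_f_R0 (fun l => G l h - K l h) N).
  { intros h. apply minus_sum. }
  now apply bigO_sum.
Qed.

(** * Truncated power series *)

Lemma PS_trunc_S (t : nat -> R) (n : nat) (H : R) :
  PS_trunc t (S n) H = PS_trunc t n H + t (S n) * H ^ S n.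
Proof. reflexivity. Qed.

Lemma PS_trunc_bigO (t : nat -> R) (n : nat) (s : R) :
  bigO 0 (fun h => PS_trunc t n (s * h)).
Proof.
  unfold PS_trunc. apply bigO_sum. intros i _.
  apply bigO_scal; [apply bigO_const|].
  apply bigO_weaken with i; [lia|apply bigO_pow].
Qed.

Lemma PS_trunc_degree (t : nat -> R) (n m : nat) (s : R) :
  (n <= m)%nat ->
  eq_bigO (n + 1) (fun h => PS_trunc t m (s * h)) (fun h => PS_trunc t n (s * h)).
Proof.
  intros Hnm. induction Hnm as [|m Hnm IH].
  - now apply eq_bigO_ext.
  - apply bigO_ext with
      (fun h => (PS_trunc t m (s * h) - PS_trunc t n (s * h))
                + t (S m) * (s * h) ^ S m).
    { intros h. rewrite PS_trunc_S. ring. }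
    apply bigO_plus; [exact IH|].
    apply bigO_scal; [apply bigO_const|].
    apply bigO_weaken with (S m); [lia|apply bigO_pow].
Qed.

(** The difference consists of the terms t1_i t2_j (sh)^(i+j) with i, j <= n < i + j;
    [cauchy_finite] lists them with i = l + k + 1 and j = n - l. *)
Lemma PS_trunc_mult (t1 t2 : nat -> R) (n : nat) (s : R) :
  eq_bigO (n + 1) (fun h => PS_trunc t1 n (s * h) * PS_trunc t2 n (s * h))
                  (fun h => PS_trunc (PS_mult t1 t2) n (s * h)).
Proof.
  destruct n as [|n].
  { apply eq_bigO_ext. intros h. unfold PS_trunc, PS_mult. simpl. ring. }
  apply bigO_ext with (fun h =>
    sum_f_R0 (fun k => sum_f_R0 (fun l =>
      (t1 (S (l + k)) * (s * h) ^ S (l + k)) *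
      (t2 (S n - l)%nat * (s * h) ^ (S n - l)))
      (pred (S n - k))) (pred (S n))).
  { intros h. unfold PS_trunc. rewrite cauchy_finite by lia.
    set (D := sum_f_R0 _ (pred (S n))).
    rewrite (sum_eq (fun i => PS_mult t1 t2 i * (s * h) ^ i)
      (fun k => sum_f_R0 (fun p => t1 p * (s * h) ^ p *
        (t2 (k - p)%nat * (s * h) ^ (k - p))) k)); [ring|].
    intros k _. unfold PS_mult. rewrite Rmult_comm, scal_sum.
    apply sum_eq. intros p Hp.
    replace ((s * h) ^ k) with ((s * h) ^ p * (s * h) ^ (k - p)).
    - ring.
    - rewrite <- pow_add. f_equal. lia. }
  apply bigO_sum. intros k Hk. apply bigO_sum. intros l Hl.
  apply bigO_weaken with (S (l + k) + (S n - l))%nat; [lia|].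
  apply bigO_mult; (apply bigO_scal; [apply bigO_const|apply bigO_pow]).
Qed.

Lemma PS_trunc_one (n : nat) (H : R) :
  PS_trunc (fun i => match i with O => 1 | S _ => 0 end) n H = 1.
Proof.
  induction n as [|n IH]; [unfold PS_trunc; simpl; ring|].
  rewrite PS_trunc_S, IH. ring.
Qed.

Lemma PS_trunc_inv (t : nat -> R) (n : nat) (s : R) :
  t O <> 0 ->
  eq_bigO (n + 1) (fun h => PS_trunc (PS_inv t) n (s * h) * PS_trunc t n (s * h))
                  (fun _ => 1).
Proof.
  intros Ht.
  apply eq_bigO_trans with (fun h => PS_trunc (PS_mult t (PS_inv t)) n (s * h)).
  - apply eq_bigO_trans with
      (fun h => PS_trunc t n (s * h) * PS_trunc (PS_inv t) n (s * h)).
    + apply eq_bigO_ext. intros h. ring.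
    + apply PS_trunc_mult.
  - apply eq_bigO_ext. intros h. rewrite <- (PS_trunc_one n (s * h)).
    apply sum_eq. intros i _. now rewrite PS_mult_inv.
Qed.

(** * Taylor expansion at a shifted point *)

(** Taylor-Lagrange applied to h |-> g (x + s h) on [0, h].  The factor s covers
    expansion to the left without reflecting g. *)
Lemma taylor_shift (lo hi x s : R) (g : R -> R) (n : nat) :
  smooth_on lo hi g -> lo < x < hi ->
  eq_bigO (n + 1) (fun h => g (x + s * h))
    (fun h => PS_trunc (fun j => Derive_n g j x / INR (fact j)) n (s * h)).
Proof.
  intros Hg Hx.
  set (v := fun y => g (y + x)).
  assert (Hv : smooth_on (lo - x) (hi - x) v).
  { intros k y Hy. apply ex_derive_n_comp_trans, Hg. lra. }
  (* s t stays in (lo - x, hi - x) when |t| < r; the + 1 allows s = 0. *)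
  set (r := Rmin (x - lo) (hi - x) / (Rabs s + 1)).
  assert (Hs : 0 < Rabs s + 1) by (generalize (Rabs_pos s); lra).
  assert (Hm : 0 < Rmin (x - lo) (hi - x)) by (apply Rmin_pos; lra).
  assert (Hr : 0 < r) by now apply Rdiv_lt_0_compat.
  assert (Hin : forall t, -r < t < r -> lo - x < s * t < hi - x).
  { intros t Ht.
    assert (Hst : Rabs (s * t) < Rmin (x - lo) (hi - x)).
    { rewrite Rabs_mult.
      apply Rle_lt_trans with ((Rabs s + 1) * Rabs t).
      - apply Rmult_le_compat_r; [apply Rabs_pos|lra].
      - replace (Rmin (x - lo) (hi - x)) with ((Rabs s + 1) * r)
          by (unfold r; field; lra).
        apply Rmult_lt_compat_l; [assumption|]. now apply Rabs_def1. }
    apply Rabs_def2 in Hst.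
    generalize (Rmin_l (x - lo) (hi - x)) (Rmin_r (x - lo) (hi - x)). lra. }
  assert (Hloc : forall k t, -r < t < r ->
    locally (s * t) (fun y => forall j, (j <= k)%nat -> ex_derive_n v j y)).
  { intros k t Ht. apply (locally_open_interval (lo - x) (hi - x)).
    - now apply Hin.
    - intros y Hy j _. now apply Hv. }
  assert (Hw : forall k t, -r < t < r ->
    ex_derive_n (fun h => v (s * h)) k t /\
    Derive_n (fun h => v (s * h)) k t = s ^ k * Derive_n v k (s * t)).
  { intros k t Ht. split.
    - now apply ex_derive_n_comp_scal, Hloc.
    - now apply Derive_n_comp_scal, Hloc. }
  assert (HD : bigO 0 (fun h => Derive_n v (S n) (s * h))).
  { apply continuous_scaled_bigO.
    apply (ex_derive_continuous (K := R_AbsRing) (V := R_NormedModule)).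
    apply (Hv (S (S n))). lra. }
  destruct HD as [C [e He]].
  exists (Rabs s ^ S n / INR (fact (S n)) * C).
  assert (Hre : 0 < Rmin r e) by (apply Rmin_pos; [assumption|apply cond_pos]).
  generalize (at_right_0_small _ Hre). apply filter_imp. intros h Hh.
  generalize (Rmin_l r e) (Rmin_r r e). intros Hr1 Hr2.
  destruct (Taylor_Lagrange (fun t => v (s * t)) n 0 h) as [z [Hz Hz']];
    [lra|intros t Ht k _; apply Hw; lra|].
  assert (Hbound : Rabs (Derive_n v (S n) (s * z)) <= C).
  { rewrite <- (Rmult_1_r C). apply (He z); [|lra].
    change (Rabs (z - 0) < e). rewrite Rminus_0_r, Rabs_pos_eq; lra. }
  replace (g (x + s * h)) with (v (s * h)) by (unfold v; f_equal; ring).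
  rewrite Hz', (proj2 (Hw (S n) z ltac:(lra))).
  rewrite (sum_eq _ (fun j => Derive_n g j x / INR (fact j) * (s * h) ^ j)).
  - unfold PS_trunc.
    set (T := sum_f_R0 _ n).
    assert (Hfact : 0 < INR (fact (S n))) by apply INR_fact_lt_0.
    replace (T + _ - T) with
      (/ INR (fact (S n)) * (h * s) ^ S n * Derive_n v (S n) (s * z))
      by (rewrite Rpow_mult_distr, Rminus_0_r; field; lra).
    rewrite !Rabs_mult, <- RPow_abs, Rabs_mult, (Rabs_pos_eq h) by lra.
    rewrite Rpow_mult_distr, (Rabs_pos_eq (/ _))
      by now apply Rlt_le, Rinv_0_lt_compat.
    replace (n + 1)%nat with (S n) by lia.
    replace (Rabs s ^ S n / INR (fact (S n)) * C * h ^ S n) with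
      (/ INR (fact (S n)) * (h ^ S n * Rabs s ^ S n) * C) by (field; lra).
    apply Rmult_le_compat_l; [|assumption].
    apply Rmult_le_pos; [now apply Rlt_le, Rinv_0_lt_compat|].
    apply Rmult_le_pos; apply pow_le; [lra|apply Rabs_pos].
  - intros j _. rewrite (proj2 (Hw j 0 ltac:(lra))), Rmult_0_r.
    unfold v. rewrite Derive_n_comp_trans, Rplus_0_l, Rminus_0_r, Rpow_mult_distr.
    unfold Rdiv. ring.
Qed.

(** * Derivatives of solutions *)

Lemma Ecoef_S (a kappa2 : R -> R) (i : nat) :
  Ecoef a kappa2 (S (S (S i))) =
  (fun x => Derive (fst (Ecoef a kappa2 (S (S i)))) x
            - kappa2 x / a x * snd (Ecoef a kappa2 (S (S i))) x,
   fun x => fst (Ecoef a kappa2 (S (S i))) x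
            + Derive (snd (Ecoef a kappa2 (S (S i)))) x
            - Derive a x / a x * snd (Ecoef a kappa2 (S (S i))) x).
Proof.
  change (Ecoef a kappa2 (S (S (S i)))) with
    (let (e0, e1) := Ecoef a kappa2 (S (S i)) in
      (fun x => Derive e0 x - kappa2 x / a x * e1 x,
       fun x => e0 x + Derive e1 x - Derive a x / a x * e1 x)).
  now destruct (Ecoef a kappa2 (S (S i))).
Qed.

Lemma Fcoef_S_0 (a kappa2 : R -> R) (i : nat) (x : R) :
  Fcoef a kappa2 (S (S (S i))) 0 x =
  Derive (Fcoef a kappa2 (S (S i)) 0) x + snd (Ecoef a kappa2 (S (S i))) x / a x.
Proof. reflexivity. Qed.

Lemma Fcoef_above (a kappa2 : R -> R) (i l : nat) (x : R) :
  (i < l)%nat -> Fcoef a kappa2 (S (S i)) l x = 0.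
Proof.
  intros Hl. destruct i as [|i].
  - destruct l as [|l]; [lia|reflexivity].
  - change (Fcoef a kappa2 (S (S (S i))) l) with
      (if Nat.leb l (S i) then
         fun x => Derive (Fcoef a kappa2 (S (S i)) l) x +
                  match l with
                  | O => snd (Ecoef a kappa2 (S (S i))) x / a x
                  | S l' => Fcoef a kappa2 (S (S i)) l' x
                  end
       else fun _ => 0).
    now rewrite (proj2 (Nat.leb_gt l (S i))) by lia.
Qed.

Lemma Fcoef_S_S (a kappa2 : R -> R) (i l : nat) (x : R) :
  (l <= i)%nat ->
  Fcoef a kappa2 (S (S (S i))) (S l) x =
  Derive (Fcoef a kappa2 (S (S i)) (S l)) x + Fcoef a kappa2 (S (S i)) l x.
Proof.
  intros Hl.
  change (Fcoef a kappa2 (S (S (S i))) (S l)) with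
    (if Nat.leb (S l) (S i) then
       fun x => Derive (Fcoef a kappa2 (S (S i)) (S l)) x +
                Fcoef a kappa2 (S (S i)) l x
     else fun _ => 0).
  now rewrite (proj2 (Nat.leb_le (S l) (S i))) by lia.
Qed.

Lemma smooth_on_Ecoef (lo hi : R) (a kappa2 : R -> R) (i : nat) :
  (forall x, lo < x < hi -> a x <> 0) ->
  smooth_on lo hi a -> smooth_on lo hi kappa2 ->
  smooth_on lo hi (fst (Ecoef a kappa2 (S (S i)))) /\
  smooth_on lo hi (snd (Ecoef a kappa2 (S (S i)))).
Proof.
  intros Hnz Ha Hk.
  pose proof (smooth_on_div _ _ _ _ Hnz Hk Ha) as Hka.
  pose proof (smooth_on_div _ _ _ _ Hnz (smooth_on_Derive _ _ _ Ha) Ha) as Haa.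
  induction i as [|i [IH0 IH1]].
  - split; now apply smooth_on_opp.
  - rewrite Ecoef_S. split.
    + apply smooth_on_plus; [now apply smooth_on_Derive|].
      apply smooth_on_opp. now apply (smooth_on_mult _ _ (fun x => kappa2 x / a x)).
    + apply (smooth_on_plus _ _ (fun x => _ + _)).
      * apply smooth_on_plus; [assumption|now apply smooth_on_Derive].
      * apply smooth_on_opp.
        now apply (smooth_on_mult _ _ (fun x => Derive a x / a x)).
Qed.

Lemma smooth_on_Fcoef (lo hi : R) (a kappa2 : R -> R) (i : nat) :
  (forall x, lo < x < hi -> a x <> 0) ->
  smooth_on lo hi a -> smooth_on lo hi kappa2 ->
  forall l, smooth_on lo hi (Fcoef a kappa2 (S (S i)) l).
Proof.
  intros Hnz Ha Hk. induction i as [|i IH]; intros [|l].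
  - apply smooth_on_div; [assumption|apply smooth_on_const|assumption].
  - apply (smooth_on_const lo hi 0).
  - apply (smooth_on_plus lo hi (Derive (Fcoef a kappa2 (S (S i)) 0)));
      [apply smooth_on_Derive, IH|].
    apply smooth_on_div; try assumption. now apply smooth_on_Ecoef.
  - destruct (Nat.le_gt_cases l i) as [Hl|Hl].
    + apply smooth_on_ext with
        (fun x => Derive (Fcoef a kappa2 (S (S i)) (S l)) x +
                  Fcoef a kappa2 (S (S i)) l x).
      { intros x _. now rewrite Fcoef_S_S. }
      apply smooth_on_plus; [apply smooth_on_Derive|]; apply IH.
    + apply smooth_on_ext with (fun _ => 0); [|apply smooth_on_const].
      intros x _. rewrite Fcoef_above; [reflexivity|lia].
Qed.

Lemma solution_Derive_flux (a kappa2 f u : R -> R) (x : R) :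
  solution a kappa2 f u -> 0 < x < 1 ->
  Derive (fun y => a y * Derive u y) x = f x - kappa2 x * u x.
Proof. intros Hu Hx. destruct (Hu x Hx) as [_ [_ E]]. lra. Qed.

(** A solution is only assumed to have u' and (a u')'.  Regularity is gained for u
    and for the flux p = a u' at the same time, from u' = p / a and
    p' = f - kappa2 u: each step buys one derivative of both. *)
Lemma solution_smooth (a kappa2 f u : R -> R) :
  smooth_on 0 1 a -> smooth_on 0 1 kappa2 -> smooth_on 0 1 f ->
  (forall x, 0 < x < 1 -> a x <> 0) ->
  solution a kappa2 f u -> smooth_on 0 1 u.
Proof.
  rewrite !smooth_on_diff_upto. intros Ha Hk Hf Hnz Hu.
  enough (H : forall n, diff_upto 0 1 n u /\
                        diff_upto 0 1 n (fun y => a y * Derive u y))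
    by (intros n; apply H).
  induction n as [|n [IHu IHp]].
  - split; intros k x Hk0 Hx; replace k with O by lia; exact I.
  - split; apply diff_upto_S; split.
    + intros x Hx. apply (Hu x Hx).
    + apply diff_upto_ext with (fun x => (a x * Derive u x) * / a x).
      * intros x Hx. field. auto.
      * apply (diff_upto_mult _ _ _ (fun x => a x * Derive u x)); [assumption|].
        now apply diff_upto_inv.
    + intros x Hx. apply (Hu x Hx).
    + apply diff_upto_ext with (fun x => f x + - (kappa2 x * u x)).
      * intros x Hx. now rewrite (solution_Derive_flux _ _ _ _ _ Hu Hx).
      * apply diff_upto_plus; [apply Hf|].
        apply diff_upto_opp, diff_upto_mult; [apply Hk|assumption].
Qed.

Lemma is_derive_sum_f_R0 (N : nat) (G : nat -> R -> R) (dG : nat -> R) (x : R) :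
  (forall l, (l <= N)%nat -> is_derive (G l) x (dG l)) ->
  is_derive (fun y => sum_f_R0 (fun l => G l y) N) x (sum_f_R0 dG N).
Proof.
  induction N as [|N IH]; intros H; simpl.
  - now apply (H O).
  - apply (is_derive_plus (K := R_AbsRing) (V := R_NormedModule));
      [apply IH; intros l Hl|]; apply H; lia.
Qed.

(** The nondivergence form of the equation: expand (a u')' and divide by a. *)
Lemma solution_is_derive_2 (a kappa2 f u : R -> R) (x : R) :
  (forall y, 0 < y < 1 -> a y <> 0) ->
  smooth_on 0 1 a -> smooth_on 0 1 u -> solution a kappa2 f u -> 0 < x < 1 ->
  is_derive (Derive u) x
    (- (kappa2 x / a x) * u x + - (Derive a x / a x) * Derive u x + 1 / a x * f x).
Proof.
  intros Hnz Ha Hus Hu Hx.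
  assert (E2 : ex_derive (Derive u) x).
  { apply (smooth_on_ex_derive 0 1); [now apply smooth_on_Derive|assumption]. }
  assert (Ea : ex_derive a x) by now apply (smooth_on_ex_derive 0 1).
  pose proof (solution_Derive_flux _ _ _ _ _ Hu Hx) as E.
  rewrite Derive_mult in E by assumption.
  replace (_ + _) with (Derive (Derive u) x); [now apply Derive_correct|].
  specialize (Hnz x Hx).
  apply Rmult_eq_reg_l with (a x); [|assumption].
  field_simplify; [|assumption]. lra.
Qed.

(** With phi l = f^(l), differentiating the sum of the F_{j,l} f^(l) and adding the
    contribution (E_{j,1}/a) f of u'' gives the same sum for j + 1. *)
Lemma Fcoef_sum_S (a kappa2 : R -> R) (i : nat) (x : R) (phi : nat -> R) :
  sum_f_R0 (fun l => Fcoef a kappa2 (S (S (S i))) l x * phi l) (S i) =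
  snd (Ecoef a kappa2 (S (S i))) x / a x * phi O
  + sum_f_R0 (fun l => Derive (Fcoef a kappa2 (S (S i)) l) x * phi l
                       + Fcoef a kappa2 (S (S i)) l x * phi (S l)) i.
Proof.
  set (dF := fun l => Derive (Fcoef a kappa2 (S (S i)) l) x * phi l).
  (* F_{i+2,l} vanishes for l = i + 1, so both ranges of summation can agree. *)
  assert (top : dF (S i) = 0).
  { unfold dF. rewrite (Derive_ext _ (fun _ => 0)), Derive_const; [ring|].
    intros t. apply Fcoef_above. lia. }
  assert (HdF : sum_f_R0 dF i = dF O + sum_f_R0 (fun l => dF (S l)) i).
  { rewrite <- (Rplus_0_r (sum_f_R0 dF i)), <- top, <- tech5.
    now rewrite decomp_sum by lia. }
  rewrite sum_plus. fold dF. rewrite HdF.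
  rewrite decomp_sum by lia. simpl pred. rewrite Fcoef_S_0.
  rewrite (sum_eq _ (fun l => dF (S l) + Fcoef a kappa2 (S (S i)) l x * phi (S l))).
  - rewrite sum_plus. unfold dF. ring.
  - intros l Hl. rewrite Fcoef_S_S by assumption. unfold dF. ring.
Qed.

Lemma solution_Derive_n (a kappa2 f u : R -> R) (i : nat) :
  (forall y, 0 < y < 1 -> a y <> 0) ->
  smooth_on 0 1 a -> smooth_on 0 1 kappa2 -> smooth_on 0 1 f ->
  solution a kappa2 f u -> forall x, 0 < x < 1 ->
  Derive_n u (S (S i)) x =
  fst (Ecoef a kappa2 (S (S i))) x * u x
  + snd (Ecoef a kappa2 (S (S i))) x * Derive u x
  + sum_f_R0 (fun l => Fcoef a kappa2 (S (S i)) l x * Derive_n f l x) i.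
Proof.
  intros Hnz Ha Hk Hf Hu.
  pose proof (solution_smooth _ _ _ _ Ha Hk Hf Hnz Hu) as Hus.
  induction i as [|i IH]; intros x Hx.
  - apply is_derive_unique.
    now apply (solution_is_derive_2 a kappa2 f u).
  - change (Derive_n u (S (S (S i))) x) with (Derive (Derive_n u (S (S i))) x).
    rewrite (Derive_ext_loc _ _ _
      (locally_open_interval 0 1 x _ Hx (fun y Hy => IH y Hy))).
    destruct (smooth_on_Ecoef 0 1 a kappa2 i Hnz Ha Hk) as [S0 S1].
    pose proof (smooth_on_Fcoef 0 1 a kappa2 i Hnz Ha Hk) as SF.
    apply is_derive_unique.
    assert (Dr : forall g, smooth_on 0 1 g -> is_derive g x (Derive g x)).
    { intros g Hg. now apply Derive_correct, (smooth_on_ex_derive 0 1). }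
    assert (Df : forall l, is_derive (Derive_n f l) x (Derive_n f (S l) x)).
    { intros l. apply Derive_correct. exact (Hf (S l) x Hx). }
    assert (prod : forall g1 g2 d1 d2, is_derive g1 x d1 -> is_derive g2 x d2 ->
      is_derive (fun y => g1 y * g2 y) x (d1 * g2 x + g1 x * d2)).
    { intros g1 g2 d1 d2 H1 H2.
      apply (is_derive_mult (K := R_AbsRing) g1 g2); try assumption.
      intros; apply Rmult_comm. }
    pose proof (is_derive_sum_f_R0 i
      (fun l y => Fcoef a kappa2 (S (S i)) l y * Derive_n f l y) _ x
      (fun l _ => prod _ _ _ _ (Dr _ (SF l)) (Df l))) as DS.
    pose proof (prod _ _ _ _ (Dr _ S0) (Dr _ Hus)) as D0.
    pose proof (prod _ _ _ _ (Dr _ S1)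
      (solution_is_derive_2 a kappa2 f u x Hnz Ha Hus Hu Hx)) as D1.
    pose proof (is_derive_plus (K := R_AbsRing) (V := R_NormedModule) _ _ _ _ _
      (is_derive_plus (K := R_AbsRing) (V := R_NormedModule) _ _ _ _ _ D0 D1) DS)
      as D.
    evar_last; [exact D|]. clear D DS D0 D1.
    rewrite (Fcoef_sum_S a kappa2 i x (fun l => Derive_n f l x)), Ecoef_S.
    unfold plus. cbn [fst snd AbelianMonoid.plus NormedModule.sort].
    change (Derive_n f 0 x) with (f x).
    set (S := sum_f_R0 _ i).
    match goal with |- ?A = ?B => change (A = B :> R) end.
    cbn -[S Ecoef Derive].
    unfold Rdiv. ring.
Qed.

(** Exact, with no remainder: the derivative of order j = i + l + 2 contributes
    F_{j,l} f^(l) H^j / j!, which is the term of degree i of F_l(H) times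
    f^(l) H^(l+2).  Hence degree j <= p + 2 amounts to i <= p - l. *)
Lemma solution_taylor_PS (a kappa2 f u : R -> R) (x H : R) (p : nat) :
  (forall y, 0 < y < 1 -> a y <> 0) ->
  smooth_on 0 1 a -> smooth_on 0 1 kappa2 -> smooth_on 0 1 f ->
  solution a kappa2 f u -> 0 < x < 1 ->
  PS_trunc (fun j => Derive_n u j x / INR (fact j)) (p + 2) H =
  u x * PS_trunc (E0_series a kappa2 x) (p + 2) H
  + H * Derive u x * PS_trunc (E1_series a kappa2 x) (p + 1) H
  + sum_f_R0 (fun l => Derive_n f l x * H ^ (l + 2)
                       * PS_trunc (F_series a kappa2 x l) (p - l) H) p.
Proof.
  intros Hnz Ha Hk Hf Hu Hx.
  pose proof (fun i => solution_Derive_n a kappa2 f u i Hnz Ha Hk Hf Hu x Hx) as HD.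
  induction p as [|p IH].
  - specialize (HD O). cbn [Nat.add Nat.sub sum_f_R0] in *.
    rewrite !PS_trunc_S, HD. unfold PS_trunc, F_series, E0_series, E1_series.
    cbn -[Derive Derive_n Ecoef Fcoef]. change (Derive_n f 0 x) with (f x).
    change (Derive_n u 1 x) with (Derive u x). change (Derive_n u 0 x) with (u x).
    field.
  - replace (S p + 2)%nat with (S (p + 2)) by lia.
    replace (S p + 1)%nat with (S (p + 1)) by lia.
    rewrite !PS_trunc_S, IH. replace (S (p + 2)) with (S (S (S p))) by lia.
    rewrite HD, !tech5, Nat.sub_diag.
    rewrite (sum_eq (fun l => Derive_n f l x * H ^ (l + 2) *
         PS_trunc (F_series a kappa2 x l) (S p - l) H)
      (fun l => Derive_n f l x * H ^ (l + 2) *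
         PS_trunc (F_series a kappa2 x l) (p - l) H
       + Fcoef a kappa2 (S (S (S p))) l x * Derive_n f l x
         * (H ^ S (S (S p)) / INR (fact (S (S (S p))))))).
    + rewrite sum_plus, <- scal_sum.
      set (K := INR (fact (S (S (S p))))).
      assert (K <> 0) by apply INR_fact_neq_0.
      assert (HE1 : E1_series a kappa2 x (S (p + 1)) =
                    snd (Ecoef a kappa2 (S (S (S p)))) x / K).
      { unfold E1_series. now replace (S (p + 1) + 1)%nat with (S (S (S p))) by lia. }
      assert (HF : PS_trunc (F_series a kappa2 x (S p)) 0 H =
                   Fcoef a kappa2 (S (S (S p))) (S p) x / K).
      { unfold PS_trunc, F_series. cbn [sum_f_R0 pow].
        replace (0 + S p + 2)%nat with (S (S (S p))) by lia. apply Rmult_1_r. }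
      rewrite HE1, HF.
      replace (S (p + 1)) with (S (S p)) by lia.
      replace (S p + 2)%nat with (S (S (S p))) by lia.
      set (Q := sum_f_R0 _ p). set (Q' := sum_f_R0 _ p).
      rewrite <- (tech_pow_Rmult H (S (S p))).
      replace (E0_series a kappa2 x (S (S (S p)))) with
        (fst (Ecoef a kappa2 (S (S (S p)))) x / K) by reflexivity.
      field. assumption.
    + intros l Hl. replace (S p - l)%nat with (S (p - l)) by lia.
      rewrite PS_trunc_S. unfold F_series at 2.
      replace (S (p - l) + l + 2)%nat with (S (S (S p))) by lia.
      replace (H ^ S (S (S p))) with (H ^ (l + 2) * H ^ S (p - l))
        by (rewrite <- pow_add; f_equal; lia).
      unfold Rdiv. ring.
Qed.

(** * The stencil *)

(** The contribution of the node x + s h.  The condition on c = alpha / E_1(sh)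
    enters only in the u'-term, where c E_1(sh) becomes alpha; that term carries
    a factor h, so an error O(h^(n+1)) in c costs O(h^(n+2)).  The truncation
    degrees are raised from those of [solution_taylor_PS] to those in which the
    conditions on c_0 and d_l are read. *)
Lemma weighted_shift (a kappa2 f u : R -> R) (x s : R) (c alpha : R -> R) (m n : nat) :
  (forall y, 0 < y < 1 -> a y <> 0) ->
  smooth_on 0 1 a -> smooth_on 0 1 kappa2 -> smooth_on 0 1 f ->
  solution a kappa2 f u -> 0 < x < 1 ->
  bigO 0 c -> bigO 0 alpha -> (1 <= m)%nat -> (m <= n)%nat ->
  eq_bigO (n + 1) c
    (fun h => alpha h * PS_trunc (PS_inv (E1_series a kappa2 x)) (n + 1) (s * h)) ->
  eq_bigO (m + 2) (fun h => c h * u (x + s * h))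
    (fun h => u x * (c h * PS_trunc (E0_series a kappa2 x) (n + 2) (s * h))
      + s * h * Derive u x * alpha h
      + sum_f_R0 (fun l => Derive_n f l x * (s * h) ^ (l + 2)
          * (c h * PS_trunc (F_series a kappa2 x l) (m - l) (s * h))) (m - 1)).
Proof.
  intros Hnz Ha Hk Hf Hu Hx Hc Hal Hm Hmn Ec.
  pose proof (solution_smooth _ _ _ _ Ha Hk Hf Hnz Hu) as Hus.
  destruct m as [|p]; [lia|]. replace (S p - 1)%nat with p by lia.
  apply eq_bigO_trans with (fun h => c h *
    PS_trunc (fun j => Derive_n u j x / INR (fact j)) (p + 2) (s * h)).
  { apply (eq_bigO_mult_l 0 (S p + 2)); [assumption|].
    replace (S p + 2)%nat with (p + 2 + 1)%nat by lia.
    now apply (taylor_shift 0 1). }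
  apply eq_bigO_trans with (fun h =>
    u x * (c h * PS_trunc (E0_series a kappa2 x) (p + 2) (s * h))
    + Derive u x * ((s * h) ^ 1 * (c h * PS_trunc (E1_series a kappa2 x) (p + 1) (s * h)))
    + sum_f_R0 (fun l => (Derive_n f l x * (s * h) ^ (l + 2) * c h)
        * PS_trunc (F_series a kappa2 x l) (p - l) (s * h)) p).
  { apply eq_bigO_ext. intros h.
    rewrite (solution_taylor_PS a kappa2 f) by assumption.
    rewrite Rmult_plus_distr_l, scal_sum. f_equal; [ring|].
    apply sum_eq. intros l _. ring. }
  apply eq_bigO_plus; [apply eq_bigO_plus|].
  - apply (eq_bigO_mult_l 0 (S p + 2)); [apply bigO_const|].
    apply (eq_bigO_mult_l 0 (S p + 2)); [assumption|].
    apply eq_bigO_sym.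
    replace (S p + 2)%nat with (p + 2 + 1)%nat by lia.
    apply PS_trunc_degree. lia.
  - apply eq_bigO_trans with (fun h => Derive u x * ((s * h) ^ 1 * alpha h));
      [|apply eq_bigO_ext; intros; ring].
    apply (eq_bigO_mult_l 0 (S p + 2)); [apply bigO_const|].
    replace (S p + 2)%nat with (1 + (p + 1 + 1))%nat by lia.
    apply eq_bigO_mult_l; [apply bigO_pow|].
    apply eq_bigO_trans with
      (fun h => c h * PS_trunc (E1_series a kappa2 x) (n + 1) (s * h)).
    { apply (eq_bigO_mult_l 0 (p + 1 + 1)); [assumption|].
      apply eq_bigO_sym, PS_trunc_degree. lia. }
    apply eq_bigO_trans with (fun h => alpha h *
      (PS_trunc (PS_inv (E1_series a kappa2 x)) (n + 1) (s * h) *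
       PS_trunc (E1_series a kappa2 x) (n + 1) (s * h))).
    + apply bigO_ext with (fun h =>
        PS_trunc (E1_series a kappa2 x) (n + 1) (s * h) *
        (c h - alpha h * PS_trunc (PS_inv (E1_series a kappa2 x)) (n + 1) (s * h)));
        [intros; ring|].
      apply bigO_scal; [apply PS_trunc_bigO|].
      apply bigO_weaken with (n + 1)%nat; [lia|exact Ec].
    + apply eq_bigO_trans with (fun h => alpha h * 1);
        [|apply eq_bigO_ext; intros; ring].
      apply (eq_bigO_mult_l 0 (p + 1 + 1)); [assumption|].
      apply bigO_weaken with (n + 1 + 1)%nat; [lia|].
      apply PS_trunc_inv. simpl. lra.
  - apply eq_bigO_sum. intros l Hl.
    apply eq_bigO_trans with (fun h => (Derive_n f l x * (s * h) ^ (l + 2) * c h)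
        * PS_trunc (F_series a kappa2 x l) (S p - l) (s * h));
      [|apply eq_bigO_ext; intros; ring].
    replace (S p + 2)%nat with (0 + (l + 2) + 0 + (p - l + 1))%nat by lia.
    apply eq_bigO_mult_l.
    + repeat apply bigO_mult; auto using bigO_const, bigO_pow.
    + apply eq_bigO_sym, PS_trunc_degree. lia.
Qed.

Lemma delta0_sum (g : R -> R) (x h : R) (N : nat) :
  sum_f_R0 (fun l => delta0 l * h ^ l * Derive_n g l x) N = g x.
Proof.
  induction N as [|N IH]; [simpl; ring|].
  rewrite tech5, IH. simpl delta0. ring.
Qed.

(** The weights c_1 and c_{-1} share the same alpha, so in the sum of the two
    expansions of [weighted_shift] the contributions of u'(x) are h alpha u'(x)
    and - h alpha u'(x) and cancel; c_0 is chosen to cancel those of u(x).  What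
    survives depends on the source term only.  Dispersion (f = 0, m = n) and
    accuracy both follow, hence the two parameters: m is the order that is
    asked for, n the one that the coefficients provide. *)
Lemma stencil_expansion (a kappa2 f u : R -> R) (x : R) (cm1 c0 c1 alpha : R -> R)
    (m n : nat) :
  (forall y, 0 < y < 1 -> a y <> 0) ->
  smooth_on 0 1 a -> smooth_on 0 1 kappa2 -> smooth_on 0 1 f ->
  solution a kappa2 f u -> 0 < x < 1 ->
  bigO 0 cm1 -> bigO 0 c1 -> bigO 0 alpha -> (1 <= m)%nat -> (m <= n)%nat ->
  eq_bigO (n + 1) c1
    (fun h => alpha h * PS_trunc (PS_inv (E1_series a kappa2 x)) (n + 1) h) ->
  eq_bigO (n + 1) cm1
    (fun h => alpha h * PS_trunc (PS_inv (E1_series a kappa2 x)) (n + 1) (- h)) ->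
  eq_bigO (n + 2) c0
    (fun h => - c1 h * PS_trunc (E0_series a kappa2 x) (n + 2) h
              - cm1 h * PS_trunc (E0_series a kappa2 x) (n + 2) (- h)) ->
  eq_bigO m (fun h => stencil_u cm1 c0 c1 u x h)
    (fun h => sum_f_R0 (fun l => Derive_n f l x * h ^ l *
       (c1 h * PS_trunc (F_series a kappa2 x l) (m - l) h
        + (-1) ^ l * cm1 h * PS_trunc (F_series a kappa2 x l) (m - l) (- h))) (m - 1)).
Proof.
  intros Hnz Ha Hk Hf Hu Hx Bm1 B1 Bal Hm Hmn Ec1 Ecm1 Ec0.
  assert (one : forall h, 1 * h = h) by (intros; ring).
  assert (mone : forall h, -1 * h = - h) by (intros; ring).
  assert (W1 := weighted_shift a kappa2 f u x 1 c1 alpha m n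
    Hnz Ha Hk Hf Hu Hx B1 Bal Hm Hmn).
  assert (Wm1 := weighted_shift a kappa2 f u x (-1) cm1 alpha m n
    Hnz Ha Hk Hf Hu Hx Bm1 Bal Hm Hmn).
  assert (Hc1 : eq_bigO (n + 1) c1 (fun h => alpha h *
    PS_trunc (PS_inv (E1_series a kappa2 x)) (n + 1) (1 * h))).
  { apply eq_bigO_trans with (1 := Ec1), eq_bigO_ext. intros h. now rewrite one. }
  assert (Hcm1 : eq_bigO (n + 1) cm1 (fun h => alpha h *
    PS_trunc (PS_inv (E1_series a kappa2 x)) (n + 1) (-1 * h))).
  { apply eq_bigO_trans with (1 := Ecm1), eq_bigO_ext. intros h. now rewrite mone. }
  specialize (W1 Hc1). specialize (Wm1 Hcm1).
  assert (W0 := eq_bigO_mult_l 0 (m + 2) (fun _ => u x) _ _ (bigO_const _)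
    (bigO_weaken (m + 2) (n + 2) _ ltac:(lia) Ec0)).
  pose proof (bigO_div_sqr _ _
    (eq_bigO_plus _ _ _ _ _ (eq_bigO_plus _ _ _ _ _ Wm1 W0) W1)) as W.
  revert W. apply bigO_ext_small with 1; [lra|]. intros h Hh.
  unfold stencil_u. rewrite !one, !mone.
  replace (x + - h) with (x - h) by ring.
  rewrite (sum_eq (fun l => Derive_n f l x * h ^ l * _)
    (fun l => Derive_n f l x * h ^ (l + 2)
                * (c1 h * PS_trunc (F_series a kappa2 x l) (m - l) h) * / h ^ 2
              + Derive_n f l x * (- h) ^ (l + 2)
                * (cm1 h * PS_trunc (F_series a kappa2 x l) (m - l) (- h)) * / h ^ 2)).
  - rewrite sum_plus, <- !scal_sum.
    set (A := sum_f_R0 _ _). set (B := sum_f_R0 _ _). field. lra.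
  - intros l _. rewrite !pow_add.
    replace ((- h) ^ l) with ((-1) ^ l * h ^ l)
      by (rewrite <- Rpow_mult_distr; f_equal; ring).
    field. lra.
Qed.

Theorem theorem3p2
  (a kappa2 f : R -> R)
  (Ha : smooth_on 0 1 a) (Hkappa2 : smooth_on 0 1 kappa2)
  (Hf : smooth_on 0 1 f)
  (Hapos : forall x : R, 0 < x < 1 -> 0 < a x)
  (M Mt : nat) (HMt : (1 <= Mt)%nat) (HM : (Mt <= M)%nat)
  (hmax xb : R) (Hhmax : 0 < hmax < 1) (Hxb : 0 < xb < 1)
  (Hsub : forall x : R, xb - hmax < x < xb + hmax -> 0 < x < 1)
  (cm1 c0 c1 : R -> R) (d : nat -> R -> R) (alpha : R -> R)
  (Hcm1 : smooth_on (- hmax) hmax cm1)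
  (Hc0 : smooth_on (- hmax) hmax c0)
  (Hc1 : smooth_on (- hmax) hmax c1)
  (Hd : forall l : nat, (l < Mt)%nat -> smooth_on (- hmax) hmax (d l))
  (Halpha : smooth_on (- hmax) hmax alpha) (Halpha0 : alpha 0 <> 0)
  (Ec1 : eq_bigO (M + 1) c1
     (fun h => alpha h * PS_trunc (PS_inv (E1_series a kappa2 xb)) (M + 1) h))
  (Ecm1 : eq_bigO (M + 1) cm1
     (fun h => alpha h * PS_trunc (PS_inv (E1_series a kappa2 xb)) (M + 1) (- h)))
  (Ec0 : eq_bigO (M + 2) c0
     (fun h => - c1 h * PS_trunc (E0_series a kappa2 xb) (M + 2) h
               - cm1 h * PS_trunc (E0_series a kappa2 xb) (M + 2) (- h)))
  (Ed : forall l : nat, (l < Mt)%nat ->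
     eq_bigO (Mt - l) (d l)
       (fun h => - delta0 l
                 + c1 h * PS_trunc (F_series a kappa2 xb l) (Mt - l) h
                 + (-1) ^ l * cm1 h
                   * PS_trunc (F_series a kappa2 xb l) (Mt - l) (- h))) :
  dispersion_order a kappa2 cm1 c0 c1 xb M /\
  accuracy_order a kappa2 f cm1 c0 c1 d Mt xb Mt.
Proof.
  assert (Hnz : forall x, 0 < x < 1 -> a x <> 0).
  { intros x Hx. specialize (Hapos x Hx). lra. }
  assert (Bm1 : bigO 0 cm1) by now apply (smooth_on_bigO hmax).
  assert (B1 : bigO 0 c1) by now apply (smooth_on_bigO hmax).
  assert (Bal : bigO 0 alpha) by now apply (smooth_on_bigO hmax).
  split; intros u Hu.
  - pose proof (stencil_expansion a kappa2 (fun _ => 0) u xb cm1 c0 c1 alpha M M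
      Hnz Ha Hkappa2 (smooth_on_const 0 1 0) Hu Hxb Bm1 B1 Bal
      ltac:(lia) (Nat.le_refl M) Ec1 Ecm1 Ec0) as H.
    revert H. apply bigO_ext. intros h.
    rewrite (sum_eq _ (fun _ => 0)).
    + rewrite sum_eq_R0; [ring|reflexivity].
    + intros l _. replace (Derive_n (fun _ => 0) l xb) with 0; [ring|].
      destruct l as [|l]; [reflexivity|]. now rewrite Derive_n_const.
  - pose proof (stencil_expansion a kappa2 f u xb cm1 c0 c1 alpha Mt M
      Hnz Ha Hkappa2 Hf Hu Hxb Bm1 B1 Bal HMt HM Ec1 Ecm1 Ec0) as H.
    (* An error O(h^(Mt-l)) in d_l is multiplied by h^l.  The power is written
       (1 * h) ^ l to match [bigO_pow] with s = 1. *)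
    assert (HD : eq_bigO Mt
      (fun h => sum_f_R0 (fun l => d l h * h ^ l * Derive_n f l xb) (Mt - 1))
      (fun h => sum_f_R0 (fun l => Derive_n f l xb * (1 * h) ^ l *
         (- delta0 l + c1 h * PS_trunc (F_series a kappa2 xb l) (Mt - l) h
          + (-1) ^ l * cm1 h
            * PS_trunc (F_series a kappa2 xb l) (Mt - l) (- h))) (Mt - 1))).
    { apply eq_bigO_sum. intros l Hl.
      apply eq_bigO_trans with (fun h => Derive_n f l xb * (1 * h) ^ l * d l h);
        [apply eq_bigO_ext; intros; rewrite Rmult_1_l; ring|].
      replace Mt with (0 + l + (Mt - l))%nat at 1 by lia.
      apply eq_bigO_mult_l; [|apply Ed; lia].
      apply bigO_mult; [apply bigO_const|apply bigO_pow]. }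
    pose proof (bigO_plus _ _ _ H (eq_bigO_sym _ _ _ HD)) as HL.
    revert HL. apply bigO_ext. intros h. unfold Lh.
    rewrite (sum_eq (fun l => Derive_n f l xb * (1 * h) ^ l * _)
      (fun l => Derive_n f l xb * h ^ l *
         (c1 h * PS_trunc (F_series a kappa2 xb l) (Mt - l) h
          + (-1) ^ l * cm1 h * PS_trunc (F_series a kappa2 xb l) (Mt - l) (- h))
       + - (delta0 l * h ^ l * Derive_n f l xb))).
    + rewrite sum_plus, (sum_eq (fun l => - _)
        (fun l => delta0 l * h ^ l * Derive_n f l xb * -1)) by (intros; ring).
      rewrite <- scal_sum, delta0_sum. ring.
    + intros l _. rewrite Rmult_1_l. ring.
Qed.
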